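(* Let $q\in[1,\infty)$, $s\in\mathbb{Z}_+$, $\alpha\in[0,\infty)$ and $Q_0\subsetneqq\mathbb{R}^n$ be a cube. Then, for any $f\in L^1(Q_0)$, $$\|f\|_{\Lambda_{(\alpha,q,s)}(Q_0)}=\lim_{p\to\infty}\|f\|_{jn_{(p,q,s)_{\alpha}}(Q_0)}$$ (where $p\in(1,\infty)$ and both sides are allowed to be $\infty$). Moreover, $$\Lambda_{(\alpha,q,s)}(Q_0)=\Big\{f\in\bigcap_{p\in(1,\infty)}jn_{(p,q,s)_{\alpha}}(Q_0):\ \lim_{p\to\infty}\|f\|_{jn_{(p,q,s)_{\alpha}}(Q_0)}<\infty\Big\}.$$
   Context: $\mathbb{Z}_+=\{0,1,2,\dots\}$. A cube $Q\subset\mathbb{R}^n$ has edges parallel to the coordinate axes and finite positive side length $\ell(Q)$, and is not necessarily closed. $\fint_Q f:=\frac1{|Q|}\int_Q f$. Functions are measurable and identified when equal almost everywhere. $L^q_{\mathrm{loc}}(Q_0)$ is the set of measurable $f$ on $Q_0$ with $f\mathbf{1}_E\in L^q(Q_0)$ for every bounded $E\subset Q_0$ (so it equals $L^q(Q_0)$). For $f\in L^1(Q)$, $P^{(s)}_Q(f)$ is the unique polynomial on $Q$ of degree at most $s$ with $\int_Q[f(x)-P^{(s)}_Q(f)(x)]x^\beta\,dx=0$ for all $\beta\in\mathbb{Z}_+^n$, $|\beta|\le s$. Fix $c_0\in(0,\ell(Q_0))$ (the same constant for both norms). Let $P^{(s)}_{Q,c_0}(f):=P^{(s)}_Q(f)$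 if $\ell(Q)<c_0$ and $P^{(s)}_{Q,c_0}(f):=0$ if $\ell(Q)\ge c_0$. Localized Campanato space: $\Lambda_{(\alpha,q,s)}(Q_0)$ is the set of all $f\in L^q_{\mathrm{loc}}(Q_0)$ with $$\|f\|_{\Lambda_{(\alpha,q,s)}(Q_0)}:=\sup_{Q\subset Q_0}|Q|^{-\alpha}\Big[\fint_Q|f-P^{(s)}_{Q,c_0}(f)|^q\Big]^{1/q}<\infty,$$ the supremum being over all cubes $Q$ in $Q_0$. Localized John--Nirenberg--Campanato space: for $p\in(1,\infty)$, $jn_{(p,q,s)_\alpha}(Q_0)$ is the set of all $f\in L^q_{\mathrm{loc}}(Q_0)$ with $$\|f\|_{jn_{(p,q,s)_\alpha}(Q_0)}:=\sup\Big[\sum_{j}|Q_j|\Big\{|Q_j|^{-\alpha}\Big[\fint_{Q_j}|f-P^{(s)}_{Q_j,c_0}(f)|^q\Big]^{1/q}\Big\}^p\Big]^{1/p}<\infty,$$ the supremum being over all countable (finite or infinite) collections $\{Q_j\}_j$ of cubes in $Q_0$ with pairwise disjoint interiors. Both quantities are defined in $[0,\infty]$ for every $f\in L^1(Q_0)$. *)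

(* Defs.v *)
From HB Require Import structures.
From mathcomp Require Import all_boot all_order all_algebra.
(* mpoly comes first: its notations, and its Measure structure, clash with
   mathcomp-analysis. *)
From mathcomp Require Export -(notations) mpoly.
From mathcomp Require Import all_classical all_reals all_analysis.

Set Implicit Arguments.
Unset Strict Implicit.
Unset Printing Implicit Defensive.

Import Order.TTheory GRing.Theory Num.Theory numFieldNormedType.Exports.

Local Open Scope classical_set_scope.
Local Open Scope ring_scope.

Definition rV_display : measure_display -> measure_display.
Proof. exact. Qed.

Section borel_rV.
Context {R : realType} {n : nat}.

Definition coor (i : 'I_n) (x : 'rV[R]_n) : measurableTypeR R := x ord0 i.

Let rV_set0 : g_sigma_preimage coor set0.
Proof. exact: sigma_algebra0. Qed.

Let rV_setC A : g_sigma_preimage coor A -> g_sigma_preimage coor (~` A).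
Proof. exact: sigma_algebraC. Qed.

Let rV_bigcup (F : _^nat) : (forall i, g_sigma_preimage coor (F i)) ->
  g_sigma_preimage coor (\bigcup_i (F i)).
Proof. exact: sigma_algebra_bigcup. Qed.

HB.instance Definition _ := @isMeasurable.Build
  (rV_display (measure_tuple_display default_measure_display)) 'rV[R]_n
  (g_sigma_preimage coor) rV_set0 rV_setC rV_bigcup.

Lemma measurable_coor (i : 'I_n) : measurable_fun [set: 'rV[R]_n] (coor i).
Proof.
move=> _ Y mY; rewrite setTI; apply: sub_sigma_algebra => /=.
rewrite -bigcup_seq/=; exists i => /=; first by rewrite mem_index_enum.
by exists Y => //; rewrite setTI.
Qed.

Lemma measurable_fun_coor d (T : measurableType d) (f : T -> 'rV[R]_n) :
  (forall i, measurable_fun [set: T] (coor i \o f)) ->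
  measurable_fun [set: T] f.
Proof.
move=> mf _ A mA; suff : image_set_system setT f measurable A by [].
move: A mA; apply: smallest_sub.
  by apply: sigma_algebra_image; exact: sigma_algebra_measurable.
rewrite -bigcup_seq; apply: bigcup_sub => i _ A [B mB <-].
by rewrite /image_set_system/= setTI; exact: (mf i).
Qed.

End borel_rV.

Section borel_rV_cons.
Context {R : realType} {n : nat}.

Definition rV_cons (x : measurableTypeR R * 'rV[R]_n) : 'rV[R]_n.+1 :=
  \row_i oapp (x.2 ord0) x.1 (unlift ord0 i).

Definition rV_uncons (x : 'rV[R]_n.+1) : measurableTypeR R * 'rV[R]_n :=
  (x ord0 ord0, \row_i x ord0 (lift ord0 i)).

Lemma rV_consK : cancel rV_cons rV_uncons.
Proof.
case=> a v; congr pair; first by rewrite mxE unlift_none.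
by apply/rowP => i; rewrite !mxE liftK.
Qed.

Lemma rV_unconsK : cancel rV_uncons rV_cons.
Proof.
move=> x; apply/rowP => i; rewrite mxE.
by case: unliftP => [j ->|->] //=; rewrite mxE.
Qed.

Lemma measurable_rV_cons : measurable_fun setT rV_cons.
Proof.
apply: measurable_fun_coor => i; rewrite /coor/rV_cons/comp/=.
under eq_fun do rewrite mxE.
case: (unlift ord0 i) => [j|] /=; last exact: measurable_fst.
exact: (measurableT_comp (measurable_coor j) measurable_snd).
Qed.

Lemma measurable_rV_uncons : measurable_fun setT rV_uncons.
Proof.
apply/measurable_fun_pairP; split; first exact: (measurable_coor ord0).
apply: measurable_fun_coor => i; rewrite /coor/rV_uncons/comp/=.
by under eq_fun do rewrite mxE; exact: (measurable_coor (lift ord0 i)).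
Qed.

End borel_rV_cons.

Section borel_lebesgue_step.
Local Open Scope ereal_scope.
Context {R : realType} {n : nat}.
Variable m : {sigma_finite_measure set 'rV[R]_n -> \bar R}.

Definition borel_lebesgue_step : set 'rV[R]_n.+1 -> \bar R :=
  pushforward (@lebesgue_measure R \x m) rV_cons.

Let step0 : borel_lebesgue_step set0 = 0.
Proof. by rewrite /borel_lebesgue_step /pushforward preimage_set0 measure0. Qed.

Let step_ge0 A : 0 <= borel_lebesgue_step A.
Proof. exact: (measure_ge0 (@lebesgue_measure R \x m)). Qed.

Let mpreimage (A : set 'rV[R]_n.+1) :
  measurable A -> measurable (rV_cons @^-1` A).
Proof. by move=> mA; rewrite -[X in measurable X]setTI; exact: measurable_rV_cons. Qed.

Let step_sigma_additive : semi_sigma_additive borel_lebesgue_step.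
Proof.
move=> F mF tF mUF; rewrite /borel_lebesgue_step /pushforward preimage_bigcup.
apply: measure_semi_sigma_additive.
- by move=> k; exact: mpreimage.
- apply/trivIsetP => /= i j _ _ ij; rewrite -preimage_setI.
  by move/trivIsetP : tF => /(_ _ _ _ _ ij) ->//; rewrite preimage_set0.
- by rewrite -preimage_bigcup; exact: mpreimage.
Qed.

HB.instance Definition _ := isMeasure.Build _ _ _ borel_lebesgue_step
  step0 step_ge0 step_sigma_additive.

Let step_sigma_finite : sigma_finite setT borel_lebesgue_step.
Proof.
have /sigma_finiteP[F [TF ndF Foo]] := sigma_finiteT (@lebesgue_measure R).
have /sigma_finiteP[G [TG ndG Goo]] := sigma_finiteT m.
exists (fun k => rV_uncons @^-1` (F k `*` G k)).
  apply/esym; rewrite -subTset => x _.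
  have [k _ Fk] : (\bigcup_k F k) (rV_uncons x).1 by rewrite -TF.
  have [l _ Gl] : (\bigcup_k G k) (rV_uncons x).2 by rewrite -TG.
  exists (maxn k l) => //; split.
  - by move: Fk; exact/subsetPset/ndF/leq_maxl.
  - by move: Gl; exact/subsetPset/ndG/leq_maxr.
move=> k; have [mF Fk] := Foo k; have [mG Gk] := Goo k; split.
  rewrite -[X in measurable X]setTI.
  by apply: measurable_rV_uncons => //; exact: measurableX.
rewrite /borel_lebesgue_step /pushforward -comp_preimage.
rewrite (_ : _ \o _ = id); last by apply/funext => x; exact: rV_consK.
by rewrite product_measure1E// lte_mul_pinfty// ge0_fin_numE.
Qed.

HB.instance Definition _ := Measure_isSigmaFinite.Build _ _ _
  borel_lebesgue_step step_sigma_finite.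

End borel_lebesgue_step.

Fixpoint borel_lebesgue {R : realType} (n : nat) :
    {sigma_finite_measure set 'rV[R]_n -> \bar R} :=
  match n with
  | 0 => \d_(0 : 'rV[R]_0)
  | k.+1 => borel_lebesgue_step (borel_lebesgue k)
  end.

Lemma measurable_rV_box {R : realType} (n : nat)
    (A : 'I_n -> set (measurableTypeR R)) :
  (forall i, measurable (A i)) ->
  measurable [set x : 'rV[R]_n | forall i, A i (x ord0 i)].
Proof.
move=> mA; rewrite (_ : mkset _ = \bigcap_(i in [set: 'I_n]) (coor i @^-1` A i)).
  apply: fin_bigcap_measurable => // i _; rewrite -[X in measurable X]setTI.
  exact: measurable_coor.
by apply/seteqP; split=> [x Ax i _|x Ax i]; [exact: Ax|exact: (Ax i)].
Qed.

Lemma borel_lebesgue_box {R : realType} (n : nat)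
    (A : 'I_n -> set (measurableTypeR R)) :
  (forall i, measurable (A i)) ->
  borel_lebesgue n [set x : 'rV[R]_n | forall i, A i (x ord0 i)] =
  (\prod_(i < n) lebesgue_measure (A i))%E.
Proof.
elim: n A => [|n IH] A mA.
  have -> : [set x : 'rV[R]_0 | forall i, A i (x ord0 i)] = setT.
    by apply/seteqP; split=> // x _ [].
  by rewrite big_ord0 /= diracT.
rewrite big_ord_recl -IH//= /borel_lebesgue_step /pushforward.
rewrite -product_measure1E//; last first.
  by apply: (@measurable_rV_box _ _ (fun i => A (lift ord0 i))).
congr (_ _); apply/seteqP; split=> [[a v] /= H|[a v] /= [H0 H] i].
  split; first by have := H ord0; rewrite mxE unlift_none.
  by move=> i; have := H (lift ord0 i); rewrite mxE liftK.
by rewrite mxE; case: unliftP => [j ->|->] /=; [exact: H|].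
Qed.

(* R^n with the Lebesgue (Caratheodory) sigma-algebra, and Lebesgue measure. *)
Notation lebesgue_space R n :=
  (caratheodory_type (@borel_lebesgue R n)^*%mu).

Definition rV_lebesgue {R : realType} (n : nat) :
    {measure set (lebesgue_space R n) -> \bar R} :=
  @completed_measure_extension _ _ _ (@borel_lebesgue R n).

Lemma rV_lebesgue_box {R : realType} (n : nat)
    (A : 'I_n -> set (measurableTypeR R)) :
  (forall i, measurable (A i)) ->
  rV_lebesgue n [set x : 'rV[R]_n | forall i, A i (x ord0 i)] =
  (\prod_(i < n) lebesgue_measure (A i))%E.
Proof.
move=> mA; rewrite -borel_lebesgue_box//.
by apply: measurable_mu_extE; exact: measurable_rV_box.
Qed.

(* A cube is a product of intervals of a common length, each of which may or
   may not contain its endpoints ([BSide true] is a closed left end or an open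
   right end). *)
Record cube (R : realType) (n : nat) := Cube {
  corner : 'rV[R]_n ;
  side : R ;
  side_gt0 : 0 < side ;
  left_end : 'I_n -> bool ;
  right_end : 'I_n -> bool }.

Definition cube_set (R : realType) (n : nat) (Q : cube R n) : set 'rV[R]_n :=
  [set x | forall i, x ord0 i \in
    Interval (BSide (left_end Q i) (corner Q ord0 i))
             (BSide (right_end Q i) (corner Q ord0 i + side Q))].
Coercion cube_set : cube >-> set.

Section localized_spaces.
Context {R : realType} {n : nat}.
Local Notation mu := (@rV_lebesgue R n).
Implicit Types (Q : cube R n) (f : 'rV[R]_n -> R).

Definition vol Q : R := fine (mu Q).

Lemma vol_cube Q : vol Q = side Q ^+ n.
Proof.
pose A i : set (measurableTypeR R) :=
  [set` Interval (BSide (left_end Q i) (corner Q ord0 i))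
                 (BSide (right_end Q i) (corner Q ord0 i + side Q))].
rewrite /vol (_ : (Q : set _) = [set x | forall i, A i (x ord0 i)])//.
rewrite (rV_lebesgue_box (A := A)); last by move=> i; exact: measurable_itv.
rewrite (eq_bigr (fun=> (side Q)%:E)) => [|i _].
  by rewrite prodEFin /= prodr_const card_ord.
rewrite /A lebesgue_measure_itv /= lte_fin ltrDl side_gt0 -EFinB.
by rewrite addrAC subrr add0r.
Qed.

Definition Lq (q : R) (D : set 'rV[R]_n) f : Prop :=
  (f \_ D : lebesgue_space R n -> R) \in Lfun mu q%:E.

Definition Lqloc (q : R) (D : set 'rV[R]_n) f : Prop :=
  measurable_fun (D : set (lebesgue_space R n)) f /\
  forall E : set (lebesgue_space R n), measurable E ->
    bounded_set (E : set 'rV[R]_n) -> E `<=` D -> Lq q D (f \* \1_E).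

(* [msize P] is the degree of [P] plus one. *)
Definition moment_condition (s : nat) Q f (P : mpoly n R) : Prop :=
  (msize P <= s.+1)%N /\
  forall b : 'I_n -> nat, (\sum_i b i <= s)%N ->
    (\int[mu]_(x in Q)
      ((f x - meval ((x : 'rV[R]_n) ord0) P) *
       \prod_i ((x : 'rV[R]_n) ord0 i) ^+ b i)%:E = 0)%E.

(* For f in L^1(Q) exactly one polynomial satisfies the moment condition. *)
Definition poly_proj (s : nat) Q f : mpoly n R :=
  xget 0 [set P | moment_condition s Q f P].

Definition loc_poly_proj (c0 : R) (s : nat) Q f : mpoly n R :=
  if side Q < c0 then poly_proj s Q f else 0.

(* |Q|^{-alpha} [ avg_Q |f - P_{Q,c0}(f)|^q ]^{1/q} *)
Definition loc_osc (c0 alpha q : R) (s : nat) Q f : \bar R :=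
  ((vol Q `^ (- alpha))%:E *
   ((vol Q)^-1%:E *
    \int[mu]_(x in Q)
      (`|f x - meval ((x : 'rV[R]_n) ord0) (loc_poly_proj c0 s Q f)| `^ q)%:E)
   `^ q^-1)%E.

Definition Lambda_norm (c0 alpha q : R) (s : nat) (Q0 : cube R n) f : \bar R :=
  ereal_sup [set loc_osc c0 alpha q s Q f | Q in [set Q : cube R n | Q `<=` Q0]].

Definition Lambda (c0 alpha q : R) (s : nat) (Q0 : cube R n) :
    set ('rV[R]_n -> R) :=
  [set f | Lqloc q Q0 f /\ (Lambda_norm c0 alpha q s Q0 f < +oo)%E].

(* The family [Q] restricted to [D : set nat] is a finite or infinite countable
   collection of cubes of [Q0] with pairwise disjoint interiors. *)
Definition packing (Q0 : cube R n) (D : set nat) (Q : nat -> cube R n) : Prop :=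
  (forall j, D j -> Q j `<=` Q0) /\ trivIset D (fun j => (Q j : set _)°).

Definition jn_norm (c0 alpha q : R) (s : nat) (Q0 : cube R n) f (p : R) :
    \bar R :=
  ereal_sup [set ((\esum_(j in DQ.1)
                     ((vol (DQ.2 j))%:E *
                      loc_osc c0 alpha q s (DQ.2 j) f `^ p)) `^ p^-1)%E
            | DQ in [set DQ : set nat * (nat -> cube R n) |
                     packing Q0 DQ.1 DQ.2]].

Definition jn (c0 alpha q : R) (s : nat) (Q0 : cube R n) (p : R) :
    set ('rV[R]_n -> R) :=
  [set f | Lqloc q Q0 f /\ (jn_norm c0 alpha q s Q0 f p < +oo)%E].

End localized_spaces.

(* Main.v *)
(* The cubes of a packing have total volume at most |Q0|, so
     |Q|^(1/p) osc(Q) <= ||f||_jn(p) <= |Q0|^(1/p) ||f||_Lambda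
   for every cube Q in Q0 (the lower bound being the packing {Q} alone). Since
   v^(1/p) tends to 1 as p grows, both bounds are sharp in the limit. *)

Require Import Defs.
From HB Require Import structures.
From mathcomp Require Import all_boot all_order all_algebra.
From mathcomp Require Import all_classical all_reals all_analysis.

Import Order.TTheory GRing.Theory Num.Theory numFieldNormedType.Exports.

Local Open Scope classical_set_scope.
Local Open Scope ring_scope.

Lemma cvg_root1 (R : realType) (v : R) : 0 < v ->
  v `^ p^-1 @[p --> +oo] --> (1 : R).
Proof.
(* For [v] nonzero the power is [expR (p^-1 * ln v)], so it suffices that the exponent tends to
   0. *)
move=> v0; rewrite /powR gt_eqF//=.
have lim0 : p^-1 * ln v @[p --> +oo] --> (0 * ln v : R).
  apply: cvgMl; apply/gtr0_cvgV0; first exact: nbhs_pinfty_gt.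
  exact: cvg_id.
rewrite mul0r in lim0; rewrite -expR0.
exact: (cvg_comp _ _ lim0 (@continuous_expR R 0)).
Qed.

Lemma cvg_root1Ml (R : realType) (v r : R) : 0 < v ->
  v `^ p^-1 * r @[p --> +oo] --> r.
Proof.
move=> v0; have : v `^ p^-1 * r @[p --> +oo] --> (1 * r : R).
  by apply: cvgMl; exact: cvg_root1.
by rewrite mul1r.
Qed.

Section packings.
Context {R : realType} {n : nat}.
Local Notation mu := (@rV_lebesgue R n).
Implicit Types (Q : cube R n).

Lemma vol_gt0 Q : 0 < vol Q.
Proof. by rewrite vol_cube exprn_gt0// side_gt0. Qed.

Definition edge Q (i : 'I_n) : set (measurableTypeR R) :=
  [set` `]corner Q ord0 i, corner Q ord0 i + side Q[].

(** Cubes of a packing may share boundary points. Their open boxes are genuinely disjoint, yet have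
    the same volume. *)
Definition open_box Q : set 'rV[R]_n := [set x | forall i, edge Q i (x ord0 i)].

Lemma open_box_sub_interior Q : open_box Q `<=` (Q : set _)°.
Proof.
(* A neighbourhood of a matrix is witnessed by one neighbourhood per entry; the open edges serve. *)
move=> x Qx; exists (fun _ j => edge Q j) => /=.
  move=> i j; rewrite (ord1 i); apply: open_nbhs_nbhs; split; last exact: Qx.
  exact: interval_open.
move=> y Qy i; have := Qy ord0 i; rewrite /edge /= !in_itv/=.
by move=> /andP[l r]; apply/andP; split; [case: left_end|case: right_end];
  rewrite ?lteifT ?lteifF//= ltW.
Qed.

Lemma measurable_lebesgue_box (A : 'I_n -> set (measurableTypeR R)) :
  (forall i, measurable (A i)) ->
  measurable ([set x | forall i, A i (x ord0 i)] : set (lebesgue_space R n)).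
Proof.
move=> mA; apply: sub_caratheodory; apply: sub_sigma_algebra.
exact: measurable_rV_box.
Qed.

Lemma measurable_cube Q : measurable (cube_set Q : set (lebesgue_space R n)).
Proof.
apply: (measurable_lebesgue_box (fun i => [set` Interval
  (BSide (left_end Q i) (corner Q ord0 i))
  (BSide (right_end Q i) (corner Q ord0 i + side Q))])) => i.
exact: measurable_itv.
Qed.

Lemma measurable_open_box Q :
  measurable (open_box Q : set (lebesgue_space R n)).
Proof. by apply: measurable_lebesgue_box => i; exact: measurable_itv. Qed.

(** Only the lengths of the factors matter, so this covers both a cube with arbitrary ends and its
    open box. *)
Lemma mu_box_side (A : 'I_n -> set (measurableTypeR R)) Q :
  (forall i, measurable (A i)) ->
  (forall i, lebesgue_measure (A i) = (side Q)%:E) ->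
  mu [set x | forall i, A i (x ord0 i)] = (vol Q)%:E.
Proof.
move=> mA lA; rewrite rV_lebesgue_box// (eq_bigr (fun=> (side Q)%:E))//.
by rewrite prodEFin prodr_const card_ord vol_cube.
Qed.

Lemma mu_cube Q : mu Q = (vol Q)%:E.
Proof.
apply: (mu_box_side (fun i => [set` Interval
  (BSide (left_end Q i) (corner Q ord0 i))
  (BSide (right_end Q i) (corner Q ord0 i + side Q))])) => i.
  exact: measurable_itv.
rewrite lebesgue_measure_itv/= lte_fin ltrDl side_gt0 -EFinB.
by rewrite addrAC subrr add0r.
Qed.

Lemma mu_open_box Q : mu (open_box Q) = (vol Q)%:E.
Proof.
apply: mu_box_side => i; first exact: measurable_itv.
rewrite lebesgue_measure_itv/= lte_fin ltrDl side_gt0 -EFinB.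
by rewrite addrAC subrr add0r.
Qed.

(** The open boxes are disjoint subsets of [Q0], so countable additivity and monotonicity of [mu]
    give the bound. *)
Lemma esum_vol_packing (Q0 : cube R n) (D : set nat) (Q : nat -> cube R n) :
  packing Q0 D Q -> (\esum_(j in D) (vol (Q j))%:E <= (vol Q0)%:E)%E.
Proof.
move=> [QQ0 tQ].
have tB : trivIset D (fun j => open_box (Q j)).
  move=> i j Di Dj [x [xi xj]]; apply: tQ => //.
  by exists x; split; exact: open_box_sub_interior.
(* Writing [D] as a boolean predicate turns the unordered sum into a series, the form in which
   additivity of [mu] is stated. *)
rewrite -[D]set_mem_set -nneseries_esum; last first.
  by move=> j _; rewrite lee_fin ltW// vol_gt0.
under eq_eseriesr do rewrite -mu_open_box.
rewrite -(measure_bigcup mu)//; last by move=> j _; exact: measurable_open_box.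
rewrite -mu_cube; apply: le_measure; rewrite ?inE.
- by apply: bigcup_measurable => j _; exact: measurable_open_box.
- exact: measurable_cube.
- apply: bigcup_sub => j Dj; apply: subset_trans (QQ0 j Dj).
  by apply: subset_trans (@interior_subset _ _); exact: open_box_sub_interior.
Qed.

End packings.

Section norms.
Context {R : realType} {n : nat} (c0 alpha q : R) (s : nat).
Context (Q0 : cube R n) (f : 'rV[R]_n -> R).
Local Notation osc := (fun Q => loc_osc c0 alpha q s Q f).
Local Notation L := (Lambda_norm c0 alpha q s Q0 f).
Local Notation J := (jn_norm c0 alpha q s Q0 f).

Lemma loc_osc_ge0 (Q : cube R n) : (0 <= osc Q)%E.
Proof. by rewrite /loc_osc mule_ge0// ?lee_fin ?powR_ge0// poweR_ge0. Qed.

Lemma loc_osc_le_Lambda_norm (Q : cube R n) : Q `<=` Q0 -> (osc Q <= L)%E.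
Proof. by move=> QQ0; apply: ereal_sup_ubound; exists Q. Qed.

Lemma Lambda_norm_ge0 : (0 <= L)%E.
Proof. by apply: le_trans (loc_osc_ge0 Q0) _; apply: loc_osc_le_Lambda_norm. Qed.

Lemma jn_norm_le (p : R) : 0 < p -> (J p <= (vol Q0 `^ p^-1)%:E * L)%E.
Proof.
move=> p0; apply: ge_ereal_sup => _ [[D Q] /= pQ <-].
have pV : (0 <= p^-1)%R by rewrite invr_ge0 ltW.
have L0 := Lambda_norm_ge0.
(* The right side becomes [(vol Q0 * L ^ p) ^ (1/p)], so monotonicity of the root leaves a
   comparison of sums. *)
rewrite -poweR_EFin -[X in (_ * X)%E](poweRe1 L0) -(mulfV (lt0r_neq0 p0)).
rewrite poweRrM -poweRM ?poweR_ge0// ?lee_fin ?(ltW (vol_gt0 _))//.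
have sub : (\esum_(j in D) ((vol (Q j))%:E * osc (Q j) `^ p) <=
    \esum_(j in D) (L `^ p * (vol (Q j))%:E))%E.
  apply: le_esum => j Dj; rewrite muleC lee_wpmul2r ?lee_fin ?(ltW (vol_gt0 _))//.
  apply: gt0_ler_poweR; rewrite ?in_itv/= ?leey ?loc_osc_ge0 ?L0 ?(ltW p0)//.
  by apply: loc_osc_le_Lambda_norm; exact: pQ.1.
apply: gt0_ler_poweR => //.
- rewrite in_itv/= leey andbT; apply: esum_ge0 => j _.
  by rewrite mule_ge0 ?poweR_ge0// lee_fin ltW// vol_gt0.
- by rewrite in_itv/= leey andbT mule_ge0 ?poweR_ge0// lee_fin ltW// vol_gt0.
apply: le_trans sub _.
rewrite -[D]set_mem_set -nneseries_esum; last first.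
  by move=> j _; rewrite mule_ge0 ?poweR_ge0// lee_fin ltW// vol_gt0.
(* Only a real constant is pulled out of the series. If [L ^ p] is infinite, so is the bound,
   because [vol Q0] is positive. *)
have [Lfin|] := boolP (L `^ p \is a fin_num)%E; last first.
  rewrite ge0_fin_numE ?poweR_ge0// -leNgt leye_eq => /eqP ->.
  by rewrite gt0_muley ?leey// lte_fin vol_gt0.
rewrite -(fineK Lfin) nneseriesZl//; last first.
  by move=> j _; rewrite lee_fin ltW// vol_gt0.
rewrite muleC lee_wpmul2r//; first by rewrite fineK// poweR_ge0.
rewrite nneseries_esum ?set_mem_set; first exact: esum_vol_packing.
by move=> j _; rewrite lee_fin ltW// vol_gt0.
Qed.

Lemma jn_norm_ge (Q : cube R n) (p : R) : 0 < p -> Q `<=` Q0 ->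
  ((vol Q `^ p^-1)%:E * osc Q <= J p)%E.
Proof.
move=> p0 QQ0; apply: ereal_sup_ubound; exists ([set 0%N], fun=> Q) => /=.
  split => //=; exact: trivIset1.
have v0 := ltW (vol_gt0 Q).
rewrite esum_set1 ?mule_ge0 ?poweR_ge0 ?lee_fin//.
rewrite poweRM ?poweR_ge0 ?lee_fin// poweR_EFin -poweRrM mulfV ?gt_eqF//.
by rewrite poweRe1 ?loc_osc_ge0.
Qed.

(** A single cube [Q] with oscillation above [a] serves for all large [p], since its factor
    [vol Q ^ (1/p)] tends to 1. *)
Lemma near_jn_norm_gt (a : R) : (a%:E < L)%E ->
  \forall p \near +oo, (a%:E < J p)%E.
Proof.
move=> /ereal_sup_gt[_ [Q QQ0 <-] aQ].
have rQ : \forall p \near +oo, (a%:E < (vol Q `^ p^-1)%:E * osc Q)%E.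
  (* The oscillation may be infinite; the product is then infinite for every [p]. *)
  case E : (osc Q) (loc_osc_ge0 Q) aQ => [r| |]// r0.
  - rewrite lte_fin => ar; near=> p.
    rewrite -EFinM lte_fin; near: p; apply: (@cvgr_gt _ _ _ _ _ r) => //.
    exact: cvg_root1Ml (vol_gt0 Q).
  - move=> _; near=> p.
    by rewrite gt0_muley ?ltry// lte_fin powR_gt0// vol_gt0.
near=> p; apply: (@lt_le_trans _ _ ((vol Q `^ p^-1)%:E * osc Q)%E).
  by near: p.
by apply: jn_norm_ge => //; near: p; exact: nbhs_pinfty_gt.
Unshelve. all: by end_near. Qed.

Lemma near_jn_norm_lt (a : R) : (L < a%:E)%E ->
  \forall p \near +oo, (J p < a%:E)%E.
Proof.
(* Lying between 0 and a real number, [L] is itself a real [l], and the upper bound converges to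
   it. *)
move=> La; have := Lambda_norm_ge0; case E : L La => [l| |]// La l0.
near=> p; apply: (@le_lt_trans _ _ ((vol Q0 `^ p^-1)%:E * L)%E).
  by apply: jn_norm_le; near: p; exact: nbhs_pinfty_gt.
rewrite E -EFinM lte_fin; near: p; apply: (@cvgr_lt _ _ _ _ _ l).
  exact: cvg_root1Ml (vol_gt0 Q0).
by rewrite -lte_fin.
Unshelve. all: by end_near. Qed.

Lemma cvg_jn_norm : J p @[p --> +oo%R] --> L.
Proof.
case E : L Lambda_norm_ge0 => [l| |]// l0.
- have bnd (e : R) : 0 < e ->
      \forall p \near +oo, ((l - e)%:E < J p < (l + e)%:E)%E.
    move=> e0; near=> p; apply/andP; split; near: p.
    + by apply: near_jn_norm_gt; rewrite E lte_fin ltrBlDr ltrDl.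
    + by apply: near_jn_norm_lt; rewrite E lte_fin ltrDl.
  (* Convergence to a real limit means being eventually finite, for which the bounds with [e = 1]
     suffice, and convergence of the real parts. *)
  apply/fine_cvgP; split.
    near=> p; have /andP[h1 h2] : ((l - 1)%:E < J p < (l + 1)%:E)%E.
      by near: p; exact: bnd.
    by rewrite fin_numElt (lt_trans _ h1) ?ltNyr// (lt_trans h2)// ltry.
  apply/cvgrPdist_lt => e e0; near=> p.
  have : ((l - e)%:E < J p < (l + e)%:E)%E by near: p; exact: bnd.
  rewrite /comp; case: (J p) => [r| |] //=; rewrite ?ltey ?andbF// !lte_fin.
  by rewrite distrC ltr_distl.
(* When [L] is infinite, the lower estimate alone pushes [J p] above every real. *)
- apply/cvgeyPge => a; near=> p; apply: ltW; near: p.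
  by apply: near_jn_norm_gt; rewrite E ltry.
Unshelve. all: by end_near. Qed.

End norms.

Theorem proposition2p13 (R : realType) (n : nat) (q alpha c0 : R) (s : nat)
    (Q0 : cube R n)
    (hn : (0 < n)%N) (hq : 1 <= q) (halpha : 0 <= alpha)
    (hQ0 : (Q0 : set 'rV[R]_n) `<` setT)
    (hc0 : 0 < c0 < side Q0) :
  (forall f : 'rV[R]_n -> R, Lq 1 Q0 f ->
     jn_norm c0 alpha q s Q0 f p @[p --> +oo%R] --> Lambda_norm c0 alpha q s Q0 f)
  /\
  Lambda c0 alpha q s Q0 =
    [set f | [/\ forall p : R, 1 < p -> jn c0 alpha q s Q0 p f,
                cvg (jn_norm c0 alpha q s Q0 f p @[p --> +oo%R]) &
                (lim (jn_norm c0 alpha q s Q0 f p @[p --> +oo%R]) < +oo)%E]].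
Proof.
split=> [f _|]; first exact: cvg_jn_norm.
apply/seteqP; split=> f /=.
- move=> [fq Lf]; split.
  + move=> p p1; split=> //; have p0 := lt_trans ltr01 p1.
    apply: le_lt_trans (jn_norm_le _ _ _ _ _ _ _ p0) _.
    by rewrite lte_mul_pinfty ?lee_fin ?powR_ge0.
  + by apply/cvg_ex; exists (Lambda_norm c0 alpha q s Q0 f); exact: cvg_jn_norm.
  + by rewrite (cvg_lim _ (@cvg_jn_norm _ _ c0 alpha q s Q0 f)).
(* Membership for any one exponent, here 2, contains the local integrability; finiteness of
   [Lambda_norm] comes from the limit. *)
- move=> [jnf _ limf]; split; first by have [] := jnf 2 (ltr1n _ 2).
  by rewrite (cvg_lim _ (@cvg_jn_norm _ _ c0 alpha q s Q0 f)) in limf.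
Qed.
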